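(* Let $g:[0,\infty)\to[0,\infty)$ be non-decreasing with $g(0)=0$, and consider the Generalized Flow Time Problem (GFP). Let $A$ be an online algorithm of class $\mathcal{A}$. Suppose that at every release time $\tau$ (of some job $z$) values $\lambda_j\ge 0$ are assigned (possibly re-assigning earlier values, but without changing the schedule before $\tau$) to all jobs released by time $\tau$, such that, with $\gamma_j$ and $\gamma$ computed from the current values, the following hold: (P1) if, in the schedule $S_\tau$, $A$ executes job $j$ at a time $t\ge\tau$, then $\gamma_j$ is dominant at $t$; (P2) if $A$ executed job $j$ at a time $t<\tau$, then $\gamma_j$ is (still) dominant at $t$, and the scheduling decisions of $A$ for $t<\tau$ are not changed by the release of $z$; (P3) $\gamma(t)=0$ for all $t>C^\tau_{\max}$; and such that the final values $\lambda_j$ together with $\gamma$ form a feasible solution of the dual LP (i.e. $\lambda_j\ge0$, $\gamma(t)\ge 0$ and $\lambda_j-\gamma(t)\le \delta_j g(t-r_j)$ for all $j$ and $t\ge r_j$). Then $A$ is an optimal online algorithm for fractional GFP, and for every $\epsilon>0$ it is a $(1+\epsilon)$-speed $\frac{1+\epsilon}{\epsilon}$-competitive algorithm for integral GFP.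
   Context: Setting: single machine, preemption allowed; job $j$ has release time $r_j\ge0$, processing time $p_j>0$, weight $w_j>0$, revealed at $r_j$; density $\delta_j=w_j/p_j$. A schedule of speed $s$ assigns rates $x_j(t)\ge 0$, $x_j(t)=0$ for $t<r_j$, $\sum_j x_j(t)\le s$; $C_j$ is the first time at which $\int_{r_j}^{C_j}x_j=p_j$. Integral GFP: minimize $\sum_j w_j g(C_j-r_j)$. Fractional cost of a schedule: $\sum_j\delta_j\int_{r_j}^\infty g(t-r_j)x_j(t)\,dt$; an online algorithm is optimal for fractional GFP if on every instance its fractional cost equals the minimum fractional cost over all unit-speed schedules. An online algorithm (speed 1) is $\alpha$-speed $\beta$-competitive if its cost is at most $\beta$ times the optimal cost of any offline schedule of speed $1/\alpha$. Class $\mathcal{A}$: algorithms that never idle while jobs are pending and that, at each release time $\tau$, fix an ordering of the set $P_\tau$ of pending jobs and process them one at a time in this order until the next release. $S_\tau$ denotes the schedule $A$ would produce if no job were released after $\tau$, and $C^\tau_{\max}$ is the last completion time of a job of $P_\tau$ in $S_\tau$. Given values $\lambda_j$, define $\gamma_j(t)=\lambda_j-\delta_j g(t-r_j)$ for $t\ge r_j$, and $\gamma(t)=\max\{0,\max_{j: r_j\le t}\gamma_j(t)\}$ (max over jobs having values); $\gamma_j$ is dominant at $t$ if $\gamma_j(t)=\gamma(t)$. *)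

(* Defs.v *)
From HB Require Import structures.
From mathcomp Require Import all_boot all_order all_algebra finmap.
From mathcomp Require Import all_classical all_reals all_analysis.

Set Implicit Arguments.
Unset Strict Implicit.
Unset Printing Implicit Defensive.

Import Order.TTheory GRing.Theory Num.Theory.
Local Open Scope classical_set_scope.
Local Open Scope ring_scope.

(* The field [jid] is only a name: it keeps apart jobs with the same release
   time, processing time and weight, so that an instance can be a finite set. *)
Record job (R : realType) := Job {
  jid : nat; rel : R; proc : R; weight : R }.

Section JobChoice.
Variable R : realType.

Definition job_code (j : job R) : nat * (R * R * R) :=
  (jid j, (rel j, proc j, weight j)).

Definition job_decode (c : nat * (R * R * R)) : job R :=
  let: (i, (r, p, w)) := c in Job i r p w.

Lemma job_codeK : cancel job_code job_decode.
Proof. by case. Qed.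

HB.instance Definition _ := Choice.copy (job R) (can_type job_codeK).
End JobChoice.

Definition density (R : realType) (j : job R) : R := weight j / proc j.

Definition instance (R : realType) : Type := {fset job R}.

Definition valid_instance (R : realType) (I : instance R) : Prop :=
  forall j, j \in I -> [/\ 0 <= rel j, 0 < proc j & 0 < weight j].

Definition released_by (R : realType) (I : instance R) (t : R) : instance R :=
  [fset j in I | rel j <= t]%fset.

Definition released_before (R : realType) (I : instance R) (t : R) :
  instance R := [fset j in I | rel j < t]%fset.

Definition release_time (R : realType) (I : instance R) (tau : R) : Prop :=
  exists2 z, z \in I & rel z = tau.

Definition rates (R : realType) : Type := job R -> R -> R.

Definition processed (R : realType) (x : rates R) (j : job R) (t : R) : R :=
  \int[lebesgue_measure]_(u in `[rel j, t]) x j u.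

Definition schedule (R : realType) (s : R) (I : instance R) (x : rates R) :
    Prop :=
  [/\ forall j, j \in I -> measurable_fun setT (x j),
      forall j t, j \in I -> 0 <= x j t,
      forall j t, j \in I -> t < rel j -> x j t = 0,
      forall t, \sum_(j <- I) x j t <= s &
      forall j, j \in I ->
        exists2 C, rel j <= C & processed x j C = proc j].

(* In a schedule [processed x j] is continuous, so this infimum is attained. *)
Definition completion (R : realType) (x : rates R) (j : job R) : R :=
  inf [set C | rel j <= C /\ processed x j C = proc j].

Definition pending (R : realType) (x : rates R) (j : job R) (t : R) : bool :=
  (rel j <= t) && (processed x j t < proc j).

Definition pending_jobs (R : realType) (I : instance R) (x : rates R) (t : R) :
  {fset job R} := [fset j in I | pending x j t]%fset.

Definition integral_cost (R : realType) (g : R -> R) (I : instance R)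
    (x : rates R) : R :=
  \sum_(j <- I) weight j * g (completion x j - rel j).

Definition fractional_cost (R : realType) (g : R -> R) (I : instance R)
    (x : rates R) : \bar R :=
  (\sum_(j <- I) (density j)%:E *
     \int[lebesgue_measure]_(t in `[rel j, +oo[)
       (g (t - rel j) * x j t)%:E)%E.

Definition algorithm (R : realType) : Type := instance R -> rates R.

(* A unit-speed algorithm; its decision at time [t] may only depend on the
   jobs released at or before [t]. *)
Definition online (R : realType) (A : algorithm R) : Prop :=
  (forall I, valid_instance I -> schedule 1 I (A I)) /\
  (forall I I' t, valid_instance I -> valid_instance I' ->
     released_by I t = released_by I' t ->
     forall j, j \in released_by I t -> A I j t = A I' j t).

(* [s] is the ordering fixed at the release time [tau]: as long as no other
   job is released, the first job of [s] that is still pending runs alone at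
   full rate, so the machine idles only when no job is pending. *)
Definition class_A (R : realType) (A : algorithm R) : Prop :=
  forall I tau, valid_instance I -> release_time I tau ->
  exists2 s : seq (job R), perm_eq s (pending_jobs I (A I) tau) &
    forall t, tau <= t -> (forall i, i \in I -> ~~ (tau < rel i <= t)) ->
    forall j, j \in I ->
      A I j t = (ohead [seq i <- s | pending (A I) i t] == Some j)%:R.

Definition optimal_fractional (R : realType) (g : R -> R) (A : algorithm R) :
    Prop :=
  forall I, valid_instance I ->
    (exists2 x, schedule 1 I x &
       fractional_cost g I (A I) = fractional_cost g I x) /\
    (forall x, schedule 1 I x ->
       (fractional_cost g I (A I) <= fractional_cost g I x)%E).

Definition speed_competitive (R : realType) (g : R -> R) (alpha beta : R)
    (A : algorithm R) : Prop :=
  forall I, valid_instance I -> forall x, schedule alpha^-1 I x ->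
    integral_cost g I (A I) <= beta * integral_cost g I x.

Definition executes (R : realType) (x : rates R) (j : job R) (t : R) : Prop :=
  0 < x j t.

Definition curve (R : realType) (g : R -> R) (lambda : job R -> R)
    (j : job R) (t : R) : R :=
  lambda j - density j * g (t - rel j).

Definition envelope (R : realType) (g : R -> R) (I : instance R)
    (lambda : job R -> R) (t : R) : R :=
  \big[Num.max/0]_(j <- I | rel j <= t) curve g lambda j t.

Definition dominant (R : realType) (g : R -> R) (I : instance R)
    (lambda : job R -> R) (j : job R) (t : R) : Prop :=
  rel j <= t /\ curve g lambda j t = envelope g I lambda t.

(* The schedule that [A] produces if no job is released after [tau]. *)
Definition schedule_at (R : realType) (A : algorithm R) (I : instance R)
  (tau : R) : rates R := A (released_by I tau).

(* The jobs pending at [tau] complete after [tau], and some job is pending at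
   a release time, so the default value [tau] is never the maximum there. *)
Definition last_completion (R : realType) (A : algorithm R) (I : instance R)
    (tau : R) : R :=
  \big[Num.max/tau]_(j <- pending_jobs (released_by I tau)
                            (schedule_at A I tau) tau)
    completion (schedule_at A I tau) j.

Definition P1 (R : realType) (g : R -> R) (A : algorithm R) (I : instance R)
    (tau : R) (lambda : job R -> R) : Prop :=
  forall j t, j \in released_by I tau -> tau <= t ->
    executes (schedule_at A I tau) j t ->
    dominant g (released_by I tau) lambda j t.

Definition P2 (R : realType) (g : R -> R) (A : algorithm R) (I : instance R)
    (tau : R) (lambda : job R -> R) : Prop :=
  (forall j t, j \in released_by I tau -> t < tau ->
     executes (schedule_at A I tau) j t ->
     dominant g (released_by I tau) lambda j t) /\
  (forall j t, j \in released_before I tau -> t < tau ->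
     schedule_at A I tau j t = A (released_before I tau) j t).

Definition P3 (R : realType) (g : R -> R) (A : algorithm R) (I : instance R)
    (tau : R) (lambda : job R -> R) : Prop :=
  forall t, last_completion A I tau < t ->
    envelope g (released_by I tau) lambda t = 0.

Definition dual_feasible (R : realType) (g : R -> R) (I : instance R)
    (lambda : job R -> R) (gamma : R -> R) : Prop :=
  [/\ forall j, j \in I -> 0 <= lambda j,
      forall t, 0 <= gamma t &
      forall j t, j \in I -> rel j <= t ->
        lambda j - gamma t <= density j * g (t - rel j)].

(* [lambda tau] are the values in force after the release time [tau]; on
   [released_by I tau] they may differ from those of earlier release times.
   The final values are those assigned at the last release time. *)
Definition dual_assignment (R : realType) (g : R -> R) (A : algorithm R)
    (I : instance R) (lambda : R -> job R -> R) : Prop :=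
  (forall tau, release_time I tau ->
     [/\ forall j, j \in released_by I tau -> 0 <= lambda tau j,
         P1 g A I tau (lambda tau),
         P2 g A I tau (lambda tau) &
         P3 g A I tau (lambda tau)]) /\
  (forall tau, release_time I tau -> (forall j, j \in I -> rel j <= tau) ->
     dual_feasible g I (lambda tau) (envelope g I (lambda tau))).

(* Main.v *)
Require Import Defs.
From mathcomp Require Import all_boot all_order all_algebra finmap.
From mathcomp Require Import all_classical all_reals all_analysis.
From mathcomp Require Import measurable_realfun lra.
(* Again, so that [rel] is the release time and not [ssrbool.rel]. *)
Require Import Defs.

Set Implicit Arguments.
Unset Strict Implicit.
Unset Printing Implicit Defensive.

Import Order.TTheory GRing.Theory Num.Theory.
Local Open Scope ring_scope.

(* The final dual values are not used directly: they may leave [gamma] positive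
   while the machine idles between two busy periods.  Each job and each time
   instead takes the values in force after the last release of its busy period;
   by P3 the pieces glue to a feasible pair [(lambda, gamma)] for which, outside
   finitely many times, [gamma t = 0] or the machine of [A] is fully used, while
   [lambda j - gamma t = density j * g (t - rel j)] whenever [A] runs [j] at [t].

   Compare [A] with another schedule [x].  Both bounds follow by integrating an
   inequality that holds at almost every time [t]; neither involves the integral
   of [gamma].  For the integral cost, [x] has speed [s = (1 + eps)^-1], and the
   inequality gives [(1 - s) * \sum_j lambda j * proc j <= integral_cost g I x].
   On the other side [density j * g (t - rel j) <= lambda j] at times [t] before
   the completion [C_j] of [j] in [A] at which [A] runs [j].  Passing to
   [t = C_j] requires [g] to be left-continuous on positive reals.  This is not
   assumed but forced by the hypothesis on [A] for instances with two jobs of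
   density 1, whose dual values give an exchange inequality for [g]. *)

(** * Integrals of measurable rates with values in [[0, s]] *)

Section BoundedRate.
Variable R : realType.
Local Notation mu := (@lebesgue_measure R).
Variables (f : R -> R) (s : R).
Hypotheses (mf : measurable_fun setT f) (f_ge0 : forall t, 0 <= f t)
  (f_le : forall t, f t <= s).

Lemma bounded_rate_integrable (a b : R) :
  mu.-integrable `[a, b]%classic (EFin \o f).
Proof.
apply: measurable_bounded_integrable => //.
- by rewrite /= lebesgue_measure_itv /=; case: ifP => _; rewrite ?ltry// -EFinB ltry.
- exact: measurable_funTS.
- exists s; split; first by rewrite num_real.
  by move=> M sM t _ /=; rewrite ger0_norm// (le_trans (f_le t))// ltW.
Qed.

(** The endpoints are null, so bounds on the open interval suffice; later uses know the rate only
    strictly between two events. *)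
Lemma Rintegral_increment_bounds (a b c d e : R) : a <= b -> b <= c ->
  (forall u, b < u < c -> d <= f u <= e) ->
  d * (c - b) <= \int[mu]_(u in `[a, c]) f u - \int[mu]_(u in `[a, b]) f u
    <= e * (c - b).
Proof.
move=> ab bc f_de.
rewrite Rintegral_itvB//; last exact: bounded_rate_integrable.
have iobc : mu.-integrable `]b, c[%classic (EFin \o f).
  apply: integrableS (bounded_rate_integrable b c) => //.
  exact: subset_itv_oo_cc.
rewrite -Rintegral_itv_bndo_bndc//.
have cst_oo (k : R) : \int[mu]_(u in `]b, c[) k = k * (c - b).
  rewrite Rintegral_cst//=; rewrite lebesgue_measure_itv/= lte_fin.
  by case: ltgtP bc => // ->; rewrite subrr.
have icst (k : R) : mu.-integrable `]b, c[%classic (EFin \o fun=> k).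
  apply: measurable_bounded_integrable => //.
    by rewrite /= lebesgue_measure_itv /=; case: ifP => _; rewrite ?ltry// -EFinB ltry.
  by exists `|k|; split; [rewrite num_real|move=> M kM t _ /=; rewrite ltW].
apply/andP; split; rewrite -cst_oo; apply: le_Rintegral => // u /=;
  by rewrite in_itv/= => /f_de/andP[].
Qed.

Lemma integral_supported (a b : R) :
  (forall t, t < a -> f t = 0) -> (forall t, b < t -> f t = 0) ->
  (\int[mu]_t (f t)%:E = (\int[mu]_(u in `[a, b]) f u)%R%:E)%E.
Proof.
move=> f_lt f_gt.
rewrite -[LHS]/(\int[mu]_(t in setT) _)%E [LHS](_ : _ = \int[mu]_(t in `[a, b]) (f t)%:E)%E.
  rewrite /Rintegral fineK//.
  by apply: integrable_fin_num => //; exact: bounded_rate_integrable.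
rewrite [RHS]integral_mkcond; apply: eq_integral => t _.
rewrite patchE; case: ifPn => //; rewrite notin_setE /= in_itv/= => /negP.
by rewrite negb_and -!ltNge => /orP[/f_lt|/f_gt] ->.
Qed.

Lemma Rintegral_le_integral (a b : R) :
  ((\int[mu]_(u in `[a, b]) f u)%R%:E <= \int[mu]_t (f t)%:E)%E.
Proof.
rewrite /Rintegral fineK; last first.
  by apply: integrable_fin_num => //; exact: bounded_rate_integrable.
apply: ge0_subset_integral => //; first exact/measurable_EFinP.
by move=> t _; rewrite lee_fin.
Qed.

End BoundedRate.

(** * Integrals of finite linear combinations, and comparison off a finite set *)

Section IntegralLemmas.
Variable R : realType.
Local Notation mu := (@lebesgue_measure R).

Lemma measurable_lincomb (T : eqType) (r : seq T) (c : T -> R)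
    (f : T -> R -> R) :
  (forall i, i \in r -> measurable_fun setT (f i)) ->
  measurable_fun [set: R] (fun t => \sum_(j <- r) c j * f j t).
Proof.
elim: r => [|j r IHr] mf.
  by under eq_fun do rewrite big_nil; exact: measurable_cst.
under eq_fun do rewrite big_cons.
apply: measurable_funD.
  by apply: measurable_funM => //; apply: mf; rewrite inE eqxx.
by apply: IHr => k kr; apply: mf; rewrite inE kr orbT.
Qed.

Lemma ge0_integral_lincomb (T : eqType) (r : seq T) (c : T -> R)
    (f : T -> R -> R) :
  (forall i, i \in r -> measurable_fun setT (f i)) ->
  (forall i t, i \in r -> 0 <= f i t) -> (forall i, i \in r -> 0 <= c i) ->
  (\int[mu]_t (\sum_(i <- r) c i * f i t)%:E =
    \sum_(i <- r) (c i)%:E * \int[mu]_t (f i t)%:E)%E.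
Proof.
elim: r => [|i r IH] mf f0 c0.
  by rewrite big_nil; under eq_integral do rewrite big_nil; rewrite integral0.
rewrite big_cons; under eq_integral do rewrite big_cons EFinD EFinM.
have m_sum : measurable_fun [set: R] (fun t => \sum_(j <- r) c j * f j t).
  by apply: measurable_lincomb => j jr; apply: mf; rewrite inE jr orbT.
have ir : i \in i :: r by rewrite inE eqxx.
rewrite ge0_integralD//=.
- rewrite ge0_integralZl_EFin//=.
  + rewrite IH// => [j jr|j t jr|j jr]; first [apply: mf|apply: f0|apply: c0];
      by rewrite inE jr orbT.
  + by move=> t _; rewrite lee_fin f0.
  + by apply/measurable_EFinP; exact: mf.
  + exact: c0.
- by move=> t _; rewrite -EFinM lee_fin mulr_ge0 ?c0 ?f0.
- by apply/measurable_EFinP; apply: measurable_funM => //; exact: mf.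
- move=> t _; rewrite lee_fin big_seq sumr_ge0// => j jr.
  by rewrite mulr_ge0 ?c0 ?f0// inE jr orbT.
- exact/measurable_EFinP.
Qed.

Lemma le_integral_off_finite (N : seq R) (f1 f2 : R -> R) :
  measurable_fun setT f1 -> measurable_fun setT f2 ->
  (forall t, 0 <= f1 t) -> (forall t, 0 <= f2 t) ->
  (forall t, t \notin N -> f1 t <= f2 t) ->
  (\int[mu]_t (f1 t)%:E <= \int[mu]_t (f2 t)%:E)%E.
Proof.
move=> mf1 mf2 f10 f20 f12; apply: ae_ge0_le_integral => //.
- by move=> t _; rewrite lee_fin.
- exact/measurable_EFinP.
- by move=> t _; rewrite lee_fin.
- exact/measurable_EFinP.
have cN : countable [set` N]%classic by apply: finite_set_countable; exact: finite_seq.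
exists [set` N]%classic; split => //.
- exact: countable_measurable.
- exact: countable_lebesgue_measure0.
move=> t /=; apply: contra_notP => tN _.
by rewrite lee_fin f12//; apply/negP.
Qed.

End IntegralLemmas.

(** * Processed work and completion times in a schedule *)

Section Schedule.
Variables (R : realType) (s : R) (I : instance R) (x : rates R).
Hypotheses (vI : valid_instance I) (x_sched : schedule s I x).
Variable j : job R.
Hypothesis jI : j \in I.
Implicit Types t u : R.

Lemma schedule_measurable : measurable_fun setT (x j).
Proof. by case: x_sched => mx _ _ _ _; exact: mx. Qed.

Lemma schedule_ge0 t : 0 <= x j t.
Proof. by case: x_sched => _ x0 _ _ _; exact: x0. Qed.

Lemma schedule_before_release t : t < rel j -> x j t = 0.
Proof. by case: x_sched => _ _ xr _ _; exact: xr. Qed.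

Lemma schedule_le_speed t : x j t <= s.
Proof.
case: x_sched => _ x0 _ x_le _; apply: le_trans (x_le t).
rewrite (bigD1_seq j) ?fset_uniq//= lerDl big_seq_cond sumr_ge0// => i /andP[iI _].
exact: x0.
Qed.

Lemma processed_increment t u d e : rel j <= t -> t <= u ->
  (forall v, t < v < u -> d <= x j v <= e) ->
  d * (u - t) <= processed x j u - processed x j t <= e * (u - t).
Proof.
move=> rt tu xde; apply: (Rintegral_increment_bounds (s := s)) => //.
- exact: schedule_measurable.
- exact: schedule_ge0.
- exact: schedule_le_speed.
Qed.

Lemma processed_le t u : rel j <= t -> t <= u ->
  processed x j t <= processed x j u.
Proof.
move=> rt tu; have /andP[+ _] := @processed_increment t u 0 s rt tu
  (fun v _ => introT andP (conj (schedule_ge0 v) (schedule_le_speed v))).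
by rewrite mul0r subr_ge0.
Qed.

Lemma processed_lipschitz t u : rel j <= t -> t <= u ->
  processed x j u <= processed x j t + s * (u - t).
Proof.
move=> rt tu; have /andP[_] := @processed_increment t u 0 s rt tu
  (fun v _ => introT andP (conj (schedule_ge0 v) (schedule_le_speed v))).
by rewrite lerBlDl.
Qed.

Lemma processed_release : processed x j (rel j) = 0.
Proof. by rewrite /processed set_itv1 Rintegral_set1. Qed.

Lemma proc_gt0 : 0 < proc j. Proof. by have [] := vI jI. Qed.

Lemma weight_gt0 : 0 < weight j. Proof. by have [] := vI jI. Qed.

Lemma density_gt0 : 0 < density j.
Proof. by rewrite divr_gt0 ?proc_gt0 ?weight_gt0. Qed.

Let completed := [set C | rel j <= C /\ processed x j C = proc j]%classic.

Let completed_nonempty : (completed !=set0)%classic.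
Proof. by case: x_sched => _ _ _ _ /(_ j jI)[C rC pC]; exists C. Qed.

Let has_inf_completed : has_inf completed.
Proof. by split=> //; exists (rel j) => C []. Qed.

Lemma rel_le_completion : rel j <= completion x j.
Proof. by apply: lb_le_inf => // C []. Qed.

Lemma processed_completion : processed x j (completion x j) = proc j.
Proof.
apply/eqP; rewrite eq_le; apply/andP; split.
  have [C [rC pC]] := completed_nonempty; rewrite -pC.
  apply: processed_le rel_le_completion _.
  by apply: ge_inf; [case: has_inf_completed|split].
have s_ge0 : 0 <= s by exact: le_trans (schedule_ge0 0) (schedule_le_speed 0).
apply/ler_addgt0Pr => e e0.
(* Only [0 <= s] is known here, hence the divisor [s + 1]; the Lipschitz bound then changes the work
   by at most [e]. *)
have d0 : 0 < e / (s + 1) by rewrite divr_gt0// ltr_wpDl.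
have [C [rC pC] C_lt] := inf_adherent d0 has_inf_completed.
have leC : completion x j <= C.
  by apply: ge_inf; [case: has_inf_completed|split].
rewrite -pC; apply: le_trans (processed_lipschitz rel_le_completion leC) _.
rewrite lerD2l; apply: (@le_trans _ _ (s * (e / (s + 1)))).
  by rewrite ler_wpM2l// lerBlDl; exact: ltW.
by rewrite mulrCA ler_piMr ?ltW// ltr_pdivrMr ?ltr_wpDl// mul1r ltrDl.
Qed.

Lemma completion_le t : rel j <= t -> proc j <= processed x j t ->
  completion x j <= t.
Proof.
move=> rt pt; rewrite leNgt; apply/negP => tC.
have := processed_le rt (ltW tC); rewrite processed_completion => pt'.
have : completion x j <= t; last by rewrite leNgt tC.
apply: ge_inf; first by case: has_inf_completed.
by split=> //; apply/eqP; rewrite eq_le pt pt'.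
Qed.

Lemma pending_lt_completion t : pending x j t -> t < completion x j.
Proof.
move=> /andP[rt]; rewrite !ltNge; apply: contra => Ct.
by rewrite -processed_completion processed_le ?rel_le_completion.
Qed.

Lemma pending_le t u : rel j <= t -> t <= u -> pending x j u -> pending x j t.
Proof.
by move=> rt tu /andP[_ pu]; rewrite /pending rt (le_lt_trans (processed_le rt tu)).
Qed.

Lemma pending_release : pending x j (rel j).
Proof. by rewrite /pending lexx processed_release proc_gt0. Qed.

(** Only an inequality: a schedule may keep processing a job after its completion. *)
Lemma integral_rate_ge : ((proc j)%:E <= \int[lebesgue_measure]_t (x j t)%:E)%E.
Proof.
rewrite -processed_completion; apply: (Rintegral_le_integral (s := s)).
- exact: schedule_measurable.
- exact: schedule_ge0.
- exact: schedule_le_speed.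
Qed.

End Schedule.

(** * Latest releases and the jobs released so far *)

Lemma exists_max_seq (R : realDomainType) (s : seq R) (P : R -> Prop) :
  (exists2 a, a \in s & P a) ->
  exists b, [/\ b \in s, P b & forall a, a \in s -> P a -> a <= b].
Proof.
case=> a as_ Pa; pose r := [seq b <- s | `[< P b >]].
have ar : a \in r by rewrite mem_filter as_ andbT; apply/asboolP.
have : \big[Num.max/a]_(b <- r) b \in r.
  rewrite -[X in X \in _]/(\big[Num.max/a]_(b <- r) id b) big_seq.
  elim/big_ind: _ => //= u v ur vr.
  by rewrite /Num.max; case: ifP.
rewrite mem_filter => /andP[/asboolP Pb bs].
exists (\big[Num.max/a]_(b <- r) b); split => // c cs Pc.
by apply: (le_bigmax_seq a c xpredT id) => //; rewrite mem_filter cs andbT; apply/asboolP.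
Qed.

Definition busy (R : realType) (I : instance R) (x : rates R) (t : R) : Prop :=
  exists2 i, i \in I & pending x i t.

Section ReleasedBy.
Variables (R : realType) (I : instance R).
Implicit Types t : R.

Lemma mem_released_by t j : (j \in released_by I t) = (j \in I) && (rel j <= t).
Proof. by rewrite !inE. Qed.

Lemma valid_released_by t : valid_instance I -> valid_instance (released_by I t).
Proof. by move=> vI j; rewrite mem_released_by => /andP[/vI]. Qed.

Lemma latest_release t : (exists2 i, i \in I & rel i <= t) ->
  exists tau, [/\ release_time I tau, tau <= t &
    forall i, i \in I -> ~~ (tau < rel i <= t)].
Proof.
move=> [i iI it].
have [|tau [/mapP[z zI ->] tau_t tau_max]] :=
  @exists_max_seq _ [seq rel j | j <- I] (fun u => u <= t).
  by exists (rel i) => //; apply: map_f.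
exists (rel z); split => //; first by exists z.
move=> k kI; apply/negP => /andP[zk kt].
by have := tau_max _ (map_f _ kI) kt; rewrite leNgt zk.
Qed.

End ReleasedBy.

(** * Behaviour of an online algorithm of class A *)

Section ClassA.
Variables (R : realType) (A : algorithm R).
Hypotheses (A_online : online A) (A_class : class_A A).
Variable I : instance R.
Hypothesis vI : valid_instance I.
Implicit Types t u : R.

Let sched : schedule 1 I (A I). Proof. by case: A_online => AS _; exact: AS. Qed.

(** Both instances contain the same jobs released by [t], so the decisions at [t] agree on those; a
    job released in [(t, tau]] has rate 0 at [t] in both schedules. *)
Lemma online_released_by tau t j :
  (forall i, i \in I -> rel i <= t -> rel i <= tau) -> j \in released_by I tau ->
  A I j t = A (released_by I tau) j t.
Proof.
move=> t_tau jt; have := jt; rewrite mem_released_by => /andP[jI _].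
have [rt|tr] := leP (rel j) t; last first.
  have vt := valid_released_by (t := tau) vI.
  by rewrite (schedule_before_release sched)// (schedule_before_release (A_online.1 _ vt)).
apply: A_online.2 => //; first exact: valid_released_by.
  apply/fsetP => i; rewrite !mem_released_by.
  case: (boolP (i \in I)) => //= iI.
  by case: (boolP (rel i <= t)) => [/t_tau->|]; rewrite ?andbF.
by rewrite mem_released_by jI.
Qed.

(** The ordering in force at [t] was fixed at the latest release up to [t]. A job pending at [t] was
    already released and pending then, so it is listed. *)
Lemma class_A_rate t : (exists2 i, i \in I & rel i <= t) ->
  exists s : seq (job R), [/\ {subset s <= I},
    forall i, i \in I -> pending (A I) i t -> i \in s &
    forall j, j \in I ->
      A I j t = (ohead [seq i <- s | pending (A I) i t] == Some j)%:R].
Proof.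
move=> /latest_release[tau [tauI tau_t no_release]].
have [s s_perm s_rule] := A_class vI tauI.
have memE i : i \in s = (i \in I) && pending (A I) i tau.
  by rewrite (perm_mem s_perm) !inE.
exists s; split => [i|i iI pi|]; first by rewrite memE => /andP[].
  rewrite memE iI/=; apply: (pending_le sched iI _ _ pi) => //.
  have := no_release i iI; rewrite negb_and -leNgt => /orP[//|].
  by case/andP: pi => ->.
exact: s_rule.
Qed.

Lemma executes_pending t j : j \in I -> 0 < A I j t -> pending (A I) j t.
Proof.
move=> jI x_gt0; have rt : rel j <= t.
  rewrite leNgt; apply/negP => tr.
  by move: x_gt0; rewrite (schedule_before_release sched)// ltxx.
have [|s [_ _ rule]] := @class_A_rate t; first by exists j.
move: x_gt0; rewrite rule//; case: eqP => [|]; last by rewrite ltxx.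
case E : [seq _ <- _ | _] => [|k l]//= [<-] _.
have : k \in [seq i <- s | pending (A I) i t] by rewrite E inE eqxx.
by rewrite mem_filter => /andP[].
Qed.

Lemma busy_full_speed t : busy I (A I) t -> \sum_(j <- I) A I j t = 1.
Proof.
move=> [i iI pi].
have [|s [sI pend_s rule]] := @class_A_rate t; first by exists i => //; case/andP: pi.
have : i \in [seq i <- s | pending (A I) i t] by rewrite mem_filter pi pend_s.
case E : [seq _ <- _ | _] rule => [//|k l]/= rule _.
have kI : k \in I.
  have : k \in [seq i <- s | pending (A I) i t] by rewrite E inE eqxx.
  by rewrite mem_filter => /andP[_ /sI].
rewrite (bigD1_seq k) ?fset_uniq//= rule// eqxx big_seq_cond big1 ?addr0//.
move=> j /andP[jI jk]; rewrite rule//; case: eqP => // -[kj].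
by rewrite kj eqxx in jk.
Qed.

(** Unlike an arbitrary schedule, [A] runs only pending jobs, so its rate vanishes after
    completion. *)
Lemma integral_rate_eq j : j \in I ->
  (\int[lebesgue_measure]_t (A I j t)%:E = (proc j)%:E)%E.
Proof.
move=> jI; rewrite (@integral_supported _ _ 1 _ _ _ (rel j) (completion (A I) j)).
- by rewrite -[in RHS](processed_completion sched jI).
- exact: (schedule_measurable sched jI).
- by move=> t; exact: (schedule_ge0 sched jI).
- by move=> t; exact: (schedule_le_speed sched jI).
- by move=> t; exact: (schedule_before_release sched jI).
move=> t Ct; apply/eqP; rewrite eq_le (schedule_ge0 sched)// andbT leNgt.
apply/negP => /(executes_pending jI)/(pending_lt_completion sched jI).
by rewrite ltNge ltW.
Qed.

(** Otherwise no work would be done on [j] just before its completion, and all of [proc j] would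
    have been processed earlier, against the minimality of the completion time. *)
Lemma executes_near_completion j h : j \in I -> 0 < h ->
  exists t, [/\ rel j <= t, completion (A I) j - h < t & 0 < A I j t].
Proof.
move=> jI h0; pose C := completion (A I) j.
apply: contrapT => no_t.
have rC : rel j < C.
  by have := pending_lt_completion sched jI (pending_release (A I) vI jI).
pose t0 := Num.max (rel j) (C - h).
have t0C : t0 < C by rewrite gt_max rC ltrBlDr ltrDl.
have rt0 : rel j <= t0 by rewrite le_max lexx.
have idle v : t0 < v < C -> 0 <= A I j v <= 0.
  move=> /andP[tv vC]; rewrite (schedule_ge0 sched)//= leNgt.
  apply/negP => x_gt0; apply: no_t; exists v; split => //.
    exact: le_trans rt0 (ltW tv).
  by apply: le_lt_trans tv; rewrite le_max lexx orbT.
have /andP[_] := processed_increment sched jI rt0 (ltW t0C) idle.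
rewrite mul0r subr_le0 (processed_completion sched jI).
by move=> /(completion_le sched jI rt0); rewrite leNgt t0C.
Qed.

End ClassA.

(** The exceptional list [N] is there because P3 says nothing at the last completion time itself. *)
Definition complementary_slackness (R : realType) (g : R -> R) (I : instance R)
    (x : rates R) (lambda : job R -> R) (gamma : R -> R) (N : seq R) : Prop :=
  (forall j t, j \in I -> 0 < x j t ->
     lambda j - gamma t = density j * g (t - rel j)) /\
  (forall t, t \notin N -> gamma t = 0 \/ \sum_(j <- I) x j t = 1).

(** * Busy periods and their last releases *)

Section BusyPeriods.
Variables (R : realType) (I : instance R) (x : rates R).
Implicit Types t u sigma tau : R.

(** Vacuous for [sigma <= t], so every release up to [t] is a candidate for the last busy
    release. *)
Definition busy_until t sigma : Prop :=
  forall u, t <= u -> u < sigma -> busy I x u.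

Definition is_last_busy_release t tau : Prop :=
  [/\ release_time I tau, busy_until t tau &
    forall sigma, release_time I sigma -> busy_until t sigma -> sigma <= tau].

(** At an idle [t] this is the latest release up to [t]. The default 0 is taken only when no job is
    released by [t]. *)
Definition last_busy_release t : R :=
  xget 0 [set tau | is_last_busy_release t tau]%classic.

Lemma last_busy_releaseP t : (exists2 i, i \in I & rel i <= t) ->
  is_last_busy_release t (last_busy_release t).
Proof.
move=> [i iI it].
have [|tau [/mapP[z zI ->] tau_t tau_max]] :=
  @exists_max_seq _ [seq rel j | j <- I] (busy_until t).
  exists (rel i); first exact: map_f.
  by move=> u tu ui; have := le_lt_trans (le_trans it tu) ui; rewrite ltxx.
suff z_last : is_last_busy_release t (rel z) by apply: xgetI z_last.
split => //; first by exists z.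
by move=> _ [k kI <-]; apply: tau_max; exact: map_f.
Qed.

Lemma rel_le_last_busy_release t i : i \in I -> rel i <= t ->
  rel i <= last_busy_release t.
Proof.
move=> iI it; have [|_ _] := @last_busy_releaseP t; first by exists i.
apply; first by exists i.
by move=> u tu ui; have := le_lt_trans (le_trans it tu) ui; rewrite ltxx.
Qed.

(** Without idle time between them, [t] and [u] have the same candidates, hence the same maximum. *)
Lemma last_busy_release_eq t u : t <= u -> busy_until t u ->
  last_busy_release t = last_busy_release u.
Proof.
move=> tu busy_tu; have eq_until sigma : busy_until t sigma = busy_until u sigma.
  apply/propext; split=> busy_s v; first by move/(le_trans tu); exact: busy_s.
  by move=> tv vs; have [/busy_s|/busy_tu] := leP u v; apply.
rewrite /last_busy_release; congr (xget _ _); apply/seteqP.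
by split=> tau /=; rewrite /is_last_busy_release !eq_until => -[? ? max_tau];
  split=> // sigma; move: (max_tau sigma); rewrite eq_until.
Qed.

(** An idle time is wanted before any release later than the last busy release. If there is no such
    release up to [u], take [u]; otherwise maximality puts an idle time before the first of them. *)
Lemma last_busy_release_le_idle t u : (exists2 i, i \in I & rel i <= t) ->
  t <= u -> ~ busy I x u ->
  exists v, [/\ last_busy_release t <= v, v <= u, ~ busy I x v &
    forall i, i \in I -> rel i <= v -> rel i <= last_busy_release t].
Proof.
move=> /last_busy_releaseP; set tau := last_busy_release t.
move=> [_ busy_tau tau_max] tu idle_u.
have le_idle v : t <= v -> ~ busy I x v -> tau <= v.
  by move=> tv idle_v; rewrite leNgt; apply/negP => vt; apply: idle_v; exact: busy_tau.
(* Release times are negated so that a maximum yields the earliest release in [(tau, u]]. *)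
have [|no_release] := pselect (exists2 s, s \in [seq - rel j | j <- I] & tau < - s <= u);
    last first.
  exists u; split => // [|i iI iu]; first exact: le_idle.
  rewrite leNgt; apply/negP => ti; apply: no_release; exists (- rel i).
    exact: map_f.
  by rewrite opprK ti.
move=> /(@exists_max_seq _ _ (fun s => tau < - s <= u))[s [/mapP[z zI ->]]].
rewrite opprK => /andP[tau_z zu] z_min.
have : ~ busy_until t (rel z).
  by move=> /tau_max; rewrite leNgt tau_z => /(_ (ex_intro2 _ _ z zI erefl)).
move=> /existsNP[v /not_implyP[tv /not_implyP[vz idle_v]]].
exists v; split => // [||i iI iv]; [exact: le_idle|by rewrite ltW// (lt_le_trans vz)|].
rewrite leNgt; apply/negP => ti.
have := z_min _ (map_f (fun j => - rel j) iI); rewrite opprK ti/= lerN2.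
move=> /(_ (le_trans iv (le_trans (ltW vz) zu))).
by rewrite leNgt (le_lt_trans iv vz).
Qed.

End BusyPeriods.

(** * Gluing the dual values along busy periods *)

Section Certificate.
Variables (R : realType) (g : R -> R) (A : algorithm R).
Hypotheses (A_online : online A) (A_class : class_A A).
Variable I : instance R.
Hypothesis vI : valid_instance I.
Variable lambda : R -> job R -> R.
Hypothesis lambda_dual : dual_assignment g A I lambda.
Implicit Types t u : R.

Let sched : schedule 1 I (A I). Proof. by case: A_online => AS _; exact: AS. Qed.

Let last t := last_busy_release I (A I) t.

Definition busy_lambda (j : job R) : R := lambda (last (rel j)) j.

Definition busy_gamma t : R :=
  envelope g (released_by I (last t)) (lambda (last t)) t.

Lemma busy_gamma_ge0 t : 0 <= busy_gamma t.
Proof. exact: bigmax_ge_id. Qed.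

(** Up to the idle time [v], the schedule [S_tau] for [tau = last t] agrees with that of [A], since
    no release falls in [(tau, v]]; nothing is pending at [v], so all its jobs are complete. *)
Lemma last_completion_le_idle t u : (exists2 i, i \in I & rel i <= t) ->
  t <= u -> ~ busy I (A I) u -> last_completion A I (last t) <= u.
Proof.
move=> it tu idle_u.
have [v [tau_v vu idle_v no_release]] := last_busy_release_le_idle it tu idle_u.
apply: le_trans vu; rewrite -/(last t) in tau_v no_release *.
have vtau : valid_instance (released_by I (last t)) by exact: valid_released_by.
rewrite /last_completion big_seq; apply: bigmax_le => // j.
rewrite !inE => /andP[/andP[jI jtau] _].
have jI' : j \in released_by I (last t) by rewrite mem_released_by jI.
have rv : rel j <= v by exact: le_trans tau_v.
apply: (completion_le (A_online.1 _ vtau) jI' rv).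
have -> : processed (schedule_at A I (last t)) j v = processed (A I) j v.
  apply: eq_Rintegral => w; rewrite inE/= in_itv/= => /andP[_ wv].
  rewrite /schedule_at -(online_released_by A_online)// => i iI iw.
  by apply: no_release => //; exact: le_trans wv.
rewrite leNgt; apply/negP => pj; apply: idle_v; exists j => //.
by rewrite /pending rv.
Qed.

(** If the machine is busy from [rel j] to [t], then [j] and [t] use the same values and the curve
    lies below its own envelope. Otherwise an idle time separates them, and P3 for the values of [j]
    makes its curve nonpositive at [t]. *)
Lemma busy_lambda_feasible : dual_feasible g I busy_lambda busy_gamma.
Proof.
split; [|exact: busy_gamma_ge0|].
  move=> j jI; have [|tau_rel _ _] := @last_busy_releaseP _ I (A I) (rel j).
    by exists j.
  have [l_ge0 _ _ _] := lambda_dual.1 _ tau_rel; apply: l_ge0.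
  by rewrite mem_released_by jI rel_le_last_busy_release.
move=> j t jI rt; rewrite lerBlDr -lerBlDl.
have jlast : j \in released_by I (last (rel j)).
  by rewrite mem_released_by jI rel_le_last_busy_release.
have curve_le : curve g (lambda (last (rel j))) j t <=
    envelope g (released_by I (last (rel j))) (lambda (last (rel j))) t.
  by apply: (le_bigmax_seq _ j (fun i => rel i <= t)).
have [busy_rt|] := pselect (busy_until I (A I) (rel j) t).
  by move: curve_le; rewrite /curve {2 3}/last (last_busy_release_eq rt).
move=> /existsNP[u /not_implyP[ru /not_implyP[ut idle_u]]].
apply: le_trans (busy_gamma_ge0 t); apply: le_trans curve_le _.
have jr : exists2 i, i \in I & rel i <= rel j by exists j.
have [tau_rel _ _] := last_busy_releaseP (A I) jr.
have [_ _ _ ->//] := lambda_dual.1 _ tau_rel.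
exact: le_lt_trans (last_completion_le_idle jr ru idle_u) ut.
Qed.

Lemma busy_complementary_slackness :
  complementary_slackness g I (A I) busy_lambda busy_gamma
    [seq last_completion A I (rel i) | i <- I].
Proof.
split=> [j t jI x_gt0|t].
  have pj := executes_pending A_online A_class vI jI x_gt0.
  have /andP[rt _] := pj.
  have last_eq : last (rel j) = last t.
    apply: last_busy_release_eq => // u ru ut; exists j => //.
    exact: (pending_le sched jI ru (ltW ut) pj).
  have [|tau_rel _ _] := @last_busy_releaseP _ I (A I) t; first by exists j.
  have [_ P1t [P2t _] _] := lambda_dual.1 _ tau_rel.
  have jlast : j \in released_by I (last t).
    by rewrite mem_released_by jI rel_le_last_busy_release.
  have ex : executes (schedule_at A I (last t)) j t.
    rewrite /executes /schedule_at -(online_released_by A_online)// => i iI it.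
    exact: rel_le_last_busy_release.
  have [_ dom] : dominant g (released_by I (last t)) (lambda (last t)) j t.
    (* The last release of the busy period may lie on either side of [t]: P1 covers the times from
       it on, P2 the earlier ones. *)
    by have [?|?] := leP (last t) t; [exact: P1t|exact: P2t].
  by rewrite /busy_gamma -dom /busy_lambda last_eq /curve opprB addrC subrK.
move=> tN; have [?|idle_t] := pselect (busy I (A I) t).
  by right; exact: busy_full_speed.
left; have [it|no_rel] := pselect (exists2 i, i \in I & rel i <= t); last first.
  rewrite /busy_gamma /envelope big_hasC//; apply/hasPn => i.
  rewrite mem_released_by => /andP[iI _].
  by apply/negP => it; apply: no_rel; exists i.
have [[z zI tau_rel] _ _] := last_busy_releaseP (A I) it.
have tau_release : release_time I (last t) by exists z.
have [_ _ _] := lambda_dual.1 _ tau_release; apply.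
(* P3 needs a strict inequality; equality would put [t] in the exceptional list. *)
rewrite lt_neqAle last_completion_le_idle// andbT.
by apply: contra tN => /eqP <-; rewrite /last -tau_rel; apply: map_f.
Qed.

End Certificate.

(** * Weak duality for the fractional and the integral cost *)

Section WeakDuality.
Variables (R : realType) (g : R -> R).
Hypotheses (g_ge0 : forall t, 0 <= t -> 0 <= g t)
  (g_nondecreasing : forall s t, 0 <= s -> s <= t -> g s <= g t).
Variable I : instance R.
Hypothesis vI : valid_instance I.
Implicit Types t u : R.
Local Notation mu := (@lebesgue_measure R).

(* [g] is arbitrary on negative reals; the truncation makes the delay cost
   measurable on the whole line. *)
Definition delay_cost (j : job R) t : R := g (Num.max 0 (t - rel j)).

Lemma delay_costE j t : rel j <= t -> delay_cost j t = g (t - rel j).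
Proof. by move=> rt; rewrite /delay_cost max_r// subr_ge0. Qed.

Lemma delay_cost_ge0 j t : 0 <= delay_cost j t.
Proof. by apply: g_ge0; rewrite le_max lexx. Qed.

Lemma measurable_delay_cost j : measurable_fun setT (delay_cost j).
Proof.
apply: nondecreasing_measurable => // u t ut.
apply: g_nondecreasing; first by rewrite le_max lexx.
by rewrite ge_max le_max lexx/= le_max lerB ?orbT.
Qed.

Section Costs.
Variables (s : R) (x : rates R).
Hypothesis x_sched : schedule s I x.

Lemma measurable_delay_rate j : j \in I ->
  measurable_fun setT (fun t => delay_cost j t * x j t).
Proof.
move=> jI; apply: measurable_funM; first exact: measurable_delay_cost.
exact: (schedule_measurable x_sched jI).
Qed.

Lemma delay_rate_ge0 j t : j \in I -> 0 <= delay_cost j t * x j t.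
Proof. by move=> jI; rewrite mulr_ge0 ?delay_cost_ge0// (schedule_ge0 x_sched). Qed.

Lemma fractional_costE : fractional_cost g I x =
  (\int[mu]_t (\sum_(j <- I) density j * (delay_cost j t * x j t))%:E)%E.
Proof.
rewrite ge0_integral_lincomb; first last.
- by move=> j jI; rewrite ltW// (density_gt0 vI).
- by move=> j t jI; exact: delay_rate_ge0.
- by move=> j jI; exact: measurable_delay_rate.
rewrite /fractional_cost !big_seq; apply: eq_bigr => j jI; congr (_ * _)%E.
rewrite integral_mkcond; apply: eq_integral => t _; rewrite patchE.
case: ifPn => [|]; first by rewrite inE/= in_itv/= andbT => /delay_costE ->.
rewrite notin_setE/= in_itv/= andbT => /negP; rewrite -ltNge => tr.
by rewrite (schedule_before_release x_sched)// mulr0.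
Qed.

End Costs.

Variables (a : rates R) (lambda : job R -> R) (gamma : R -> R) (N : seq R).
Hypotheses (a_sched : schedule 1 I a)
  (a_total : forall j, j \in I -> (\int[mu]_t (a j t)%:E = (proc j)%:E)%E)
  (feasible : dual_feasible g I lambda gamma)
  (slackness : complementary_slackness g I a lambda gamma N).

Lemma dual_le_cost s x j t : schedule s I x -> j \in I ->
  (lambda j - gamma t) * x j t <= density j * (delay_cost j t * x j t).
Proof.
move=> x_sched jI; have [rt|tr] := leP (rel j) t; last first.
  by rewrite (schedule_before_release x_sched)// !mulr0.
rewrite mulrA ler_wpM2r ?(schedule_ge0 x_sched)// delay_costE//.
by case: feasible => _ _; apply.
Qed.

Lemma dual_eq_cost j t : j \in I ->
  (lambda j - gamma t) * a j t = density j * (delay_cost j t * a j t).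
Proof.
move=> jI; have := schedule_ge0 a_sched jI t; rewrite le_eqVlt => /predU1P[<-|at_gt0].
  by rewrite !mulr0.
have rt : rel j <= t.
  rewrite leNgt; apply/negP => tr.
  by rewrite (schedule_before_release a_sched)// ltxx in at_gt0.
by rewrite mulrA delay_costE// slackness.1.
Qed.

(** Cost minus [lambda] terms equals [- gamma t] times the total rate for [a] and is at least that
    for [x]; where [gamma t > 0], the total rate of [a] is the maximum 1. The [lambda] terms are
    moved across so that both sides are nonnegative and can be integrated. *)
Lemma pointwise_optimality x t : schedule 1 I x -> t \notin N ->
  \sum_(j <- I) density j * (delay_cost j t * a j t) +
    \sum_(j <- I) lambda j * x j t <=
  \sum_(j <- I) density j * (delay_cost j t * x j t) +
    \sum_(j <- I) lambda j * a j t.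
Proof.
move=> x_sched tN.
have gamma_le : gamma t * \sum_(j <- I) x j t <= gamma t * \sum_(j <- I) a j t.
  case: (slackness.2 t tN) => ->; first by rewrite !mul0r.
  by case: feasible => _ gamma0 _; rewrite ler_wpM2l//; case: x_sched.
have -> : \sum_(j <- I) density j * (delay_cost j t * a j t) =
    \sum_(j <- I) lambda j * a j t - gamma t * \sum_(j <- I) a j t.
  rewrite mulr_sumr -sumrB !big_seq; apply: eq_bigr => j jI.
  by rewrite -dual_eq_cost// mulrBl.
have : \sum_(j <- I) lambda j * x j t - gamma t * \sum_(j <- I) x j t <=
    \sum_(j <- I) density j * (delay_cost j t * x j t).
  rewrite mulr_sumr -sumrB !big_seq; apply: ler_sum => j jI.
  by rewrite -mulrBl; exact: dual_le_cost x_sched jI.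
by lra.
Qed.

Lemma fractional_optimality x : schedule 1 I x ->
  (fractional_cost g I a <= fractional_cost g I x)%E.
Proof.
move=> x_sched; have [l_ge0 gamma_ge0 _] := feasible.
have ml y : schedule 1 I y ->
    measurable_fun setT (fun t => \sum_(j <- I) lambda j * y j t).
  by move=> y_s; apply: measurable_lincomb => j jI; exact: (schedule_measurable y_s jI).
have mc y : schedule 1 I y -> measurable_fun setT
    (fun t => \sum_(j <- I) density j * (delay_cost j t * y j t)).
  by move=> y_s; apply: measurable_lincomb => j jI; exact: (measurable_delay_rate y_s jI).
have l0 y t : schedule 1 I y -> 0 <= \sum_(j <- I) lambda j * y j t.
  move=> y_s; rewrite big_seq sumr_ge0// => j jI.
  by rewrite mulr_ge0 ?l_ge0// (schedule_ge0 y_s).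
have c0 y t : schedule 1 I y ->
    0 <= \sum_(j <- I) density j * (delay_cost j t * y j t).
  move=> y_s; rewrite big_seq sumr_ge0// => j jI.
  by rewrite mulr_ge0 ?(delay_rate_ge0 y_s)// ltW// (density_gt0 vI).
have split_int y z : schedule 1 I y -> schedule 1 I z ->
    (\int[mu]_t (\sum_(j <- I) density j * (delay_cost j t * y j t) +
      \sum_(j <- I) lambda j * z j t)%:E =
    fractional_cost g I y +
      \sum_(j <- I) (lambda j)%:E * \int[mu]_t (z j t)%:E)%E.
  move=> y_s z_s; rewrite (fractional_costE y_s) -ge0_integral_lincomb.
  - under eq_integral do rewrite EFinD.
    rewrite ge0_integralD//; try by move=> t _; rewrite lee_fin ?c0 ?l0.
    + by apply/measurable_EFinP; exact: mc.
    + by apply/measurable_EFinP; exact: ml.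
  - by move=> j jI; exact: (schedule_measurable z_s jI).
  - by move=> j t jI; exact: (schedule_ge0 z_s jI).
  - by move=> j jI; exact: l_ge0.
(* [a] does exactly [proc j] work on each job and [x] at least that much, so the [lambda] terms
   compare with [Lambda], which is finite and cancels even if the costs are infinite. *)
pose Lambda : R := \sum_(j <- I) lambda j * proc j.
rewrite -(@leeD2rE _ Lambda%:E)//.
have -> : (fractional_cost g I x + Lambda%:E =
    \int[mu]_t (\sum_(j <- I) density j * (delay_cost j t * x j t) +
      \sum_(j <- I) lambda j * a j t)%:E)%E.
  rewrite split_int// -sumEFin !big_seq; congr (_ + _)%E.
  by apply: eq_bigr => j jI; rewrite a_total.
apply: (@le_trans _ _ (\int[mu]_t (\sum_(j <- I) density j *
    (delay_cost j t * a j t) + \sum_(j <- I) lambda j * x j t)%:E)%E).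
  rewrite split_int// leeD2l// -sumEFin !big_seq; apply: lee_sum => j jI.
  by rewrite EFinM lee_pmul ?lee_fin ?l_ge0// ?(ltW (proc_gt0 vI jI))//
    (integral_rate_ge x_sched).
apply: (le_integral_off_finite (N := N)) => [||t|t|t tN].
- by apply: measurable_funD; [exact: mc|exact: ml].
- by apply: measurable_funD; [exact: mc|exact: ml].
- by rewrite addr_ge0 ?c0 ?l0.
- by rewrite addr_ge0 ?c0 ?l0.
- exact: pointwise_optimality.
Qed.

(** Cutting [x] off at completion bounds each delay by the final one. The [gamma] term for [y] is at
    most [s] times that for [a], which the [lambda] terms of [a] dominate because costs are
    nonnegative. *)
Lemma pointwise_speedup s x t (y := fun j t => if t <= completion x j then x j t else 0) :
  schedule s I x -> t \notin N ->
  \sum_(j <- I) lambda j * y j t <=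
  \sum_(j <- I) density j * g (completion x j - rel j) * y j t +
    \sum_(j <- I) (s * lambda j) * a j t.
Proof.
move=> x_sched tN; have [l_ge0 gamma_ge0 _] := feasible.
have y_ge0 j : j \in I -> 0 <= y j t.
  by move=> jI; rewrite /y; case: ifP => // _; exact: (schedule_ge0 x_sched jI).
have y_le j : j \in I -> y j t <= x j t.
  by move=> jI; rewrite /y; case: ifP => // _; exact: (schedule_ge0 x_sched jI).
have x_le : \sum_(j <- I) x j t <= s by case: x_sched.
have sum_y : \sum_(j <- I) y j t <= s.
  by apply: le_trans x_le; rewrite !big_seq; apply: ler_sum.
have s_ge0 : 0 <= s.
  apply: le_trans x_le; rewrite big_seq sumr_ge0// => j jI.
  exact: (schedule_ge0 x_sched jI).
have gamma_le : gamma t * \sum_(j <- I) y j t <= s * (gamma t * \sum_(j <- I) a j t).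
  case: (slackness.2 t tN) => ->; first by rewrite !mul0r ?mulr0.
  by rewrite mulr1 [s * _]mulrC ler_wpM2l.
have gamma_a : gamma t * \sum_(j <- I) a j t <= \sum_(j <- I) lambda j * a j t.
  rewrite mulr_sumr !big_seq; apply: ler_sum => j jI.
  rewrite -subr_ge0 -mulrBl dual_eq_cost// mulr_ge0 ?(delay_rate_ge0 a_sched)//.
  by rewrite ltW// (density_gt0 vI).
have y_cost : \sum_(j <- I) lambda j * y j t - gamma t * \sum_(j <- I) y j t <=
    \sum_(j <- I) density j * g (completion x j - rel j) * y j t.
  rewrite mulr_sumr -sumrB !big_seq; apply: ler_sum => j jI.
  rewrite -mulrBl /y; case: (leP t (completion x j)) => [tC|_]; last by rewrite !mulr0.
  apply: le_trans (dual_le_cost t x_sched jI) _; rewrite mulrA.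
  rewrite ler_wpM2r ?(schedule_ge0 x_sched)// ler_wpM2l//.
    by rewrite ltW// (density_gt0 vI).
  apply: g_nondecreasing; first by rewrite le_max lexx.
  by rewrite ge_max subr_ge0 (rel_le_completion x_sched)//= lerB.
have -> : \sum_(j <- I) s * lambda j * a j t = s * \sum_(j <- I) lambda j * a j t.
  by rewrite mulr_sumr; apply: eq_bigr => j _; rewrite mulrA.
have := ler_wpM2l s_ge0 gamma_a.
by lra.
Qed.

Lemma dual_value_le_integral_cost s x : schedule s I x -> 0 <= s ->
  \sum_(j <- I) lambda j * proc j <=
  integral_cost g I x + s * \sum_(j <- I) lambda j * proc j.
Proof.
move=> x_sched s_ge0; have [l_ge0 gamma_ge0 _] := feasible.
pose y := fun j t => if t <= completion x j then x j t else 0.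
have my j : j \in I -> measurable_fun setT (y j).
  move=> jI; apply: measurable_fun_ifT => //; last exact: (schedule_measurable x_sched jI).
  exact: measurable_fun_ler.
have y_ge0 j t : j \in I -> 0 <= y j t.
  by move=> jI; rewrite /y; case: ifP => // _; exact: (schedule_ge0 x_sched jI).
have y_le j t : j \in I -> y j t <= s.
  move=> jI; rewrite /y; case: ifP => // _; exact: (schedule_le_speed x_sched jI).
have int_y j : j \in I -> (\int[mu]_t (y j t)%:E = (proc j)%:E)%E.
  move=> jI; rewrite (@integral_supported _ _ s _ _ _ (rel j) (completion x j)).
  - rewrite -[in RHS](processed_completion x_sched jI); congr EFin.
    by apply: eq_Rintegral => t; rewrite inE/= in_itv/= /y => /andP[_ ->].
  - exact: my.
  - by move=> t; exact: y_ge0.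
  - by move=> t; exact: y_le.
  - by move=> t tr; rewrite /y (schedule_before_release x_sched)//; case: ifP.
  - by move=> t Ct; rewrite /y leNgt Ct.
(* As [y] integrates to exactly [proc j] and [density j * proc j = weight j], the integral of the
   [c] terms is the integral cost. *)
pose c j := density j * g (completion x j - rel j).
have c_ge0 j : j \in I -> 0 <= c j.
  move=> jI; rewrite mulr_ge0// ?(ltW (density_gt0 vI jI))// g_ge0//.
  by rewrite subr_ge0 (rel_le_completion x_sched).
have ma j : j \in I -> measurable_fun setT (a j).
  by move=> jI; exact: (schedule_measurable a_sched jI).
have a_ge0 j t : j \in I -> 0 <= a j t.
  by move=> jI; exact: (schedule_ge0 a_sched jI).
have sl_ge0 j : j \in I -> 0 <= s * lambda j by move=> jI; rewrite mulr_ge0 ?l_ge0.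
have lincomb_ge0 (d : job R -> R) z t : (forall j, j \in I -> 0 <= d j) ->
    (forall j t, j \in I -> 0 <= z j t) -> 0 <= \sum_(j <- I) d j * z j t.
  by move=> d0 z0; rewrite big_seq sumr_ge0// => j jI; rewrite mulr_ge0 ?d0 ?z0.
have sum_int (d : job R -> R) z :
    (forall j, j \in I -> (\int[mu]_t (z j t)%:E = (proc j)%:E)%E) ->
    (\sum_(j <- I) (d j)%:E * \int[mu]_t (z j t)%:E =
      (\sum_(j <- I) d j * proc j)%R%:E)%E.
  by move=> zp; rewrite -sumEFin !big_seq; apply: eq_bigr => j jI; rewrite zp.
rewrite -lee_fin.
have -> : integral_cost g I x + s * \sum_(j <- I) lambda j * proc j =
    \sum_(j <- I) c j * proc j + \sum_(j <- I) (s * lambda j) * proc j.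
  congr (_ + _); last by rewrite mulr_sumr; apply: eq_bigr => j _; rewrite mulrA.
  rewrite /integral_cost !big_seq; apply: eq_bigr => j jI.
  by rewrite /c mulrAC /density divfK// gt_eqF// (proc_gt0 vI jI).
rewrite EFinD -(sum_int _ y)// -(sum_int c y)// -(sum_int _ a)//.
rewrite -!ge0_integral_lincomb//.
rewrite -ge0_integralD//=; first last.
- by apply/measurable_EFinP; exact: measurable_lincomb.
- by move=> t _; rewrite lee_fin lincomb_ge0.
- by apply/measurable_EFinP; exact: measurable_lincomb.
- by move=> t _; rewrite lee_fin lincomb_ge0.
apply: (le_integral_off_finite (N := N)) => [||t|t|t tN].
- exact: measurable_lincomb.
- by apply: measurable_funD; exact: measurable_lincomb.
- exact: lincomb_ge0.
- by rewrite addr_ge0 ?lincomb_ge0.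
- exact: pointwise_speedup.
Qed.

End WeakDuality.

(** * Left-continuity of [g] forced by the algorithm, and the bound on final delays *)

Section DualAlgorithm.
Variables (R : realType) (g : R -> R).
Hypotheses (g_ge0 : forall t, 0 <= t -> 0 <= g t)
  (g_nondecreasing : forall s t, 0 <= s -> s <= t -> g s <= g t).
Variable A : algorithm R.
Hypotheses (A_online : online A) (A_class : class_A A)
  (A_dual : forall I : instance R, valid_instance I ->
     exists lambda : R -> job R -> R, dual_assignment g A I lambda).
Implicit Types (I : instance R) (t u : R).

Lemma exists_certificate I : valid_instance I ->
  exists lambda gamma N, dual_feasible g I lambda gamma /\
    complementary_slackness g I (A I) lambda gamma N.
Proof.
move=> vI; have [lambda dual] := A_dual vI.
exists (busy_lambda A I lambda), (busy_gamma g A I lambda),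
  [seq last_completion A I (rel i) | i <- I].
split; first exact: busy_lambda_feasible.
exact: busy_complementary_slackness.
Qed.

(** Slackness holds with equality for [i] at [t] and [k] at [u], feasibility as an inequality for
    the swapped pairs; in the sum all [lambda] and [gamma] cancel. *)
Lemma exchange_inequality I i k t u : valid_instance I -> i \in I -> k \in I ->
  0 < A I i t -> 0 < A I k u -> rel i <= u -> rel k <= t ->
  density i * g (t - rel i) + density k * g (u - rel k) <=
  density i * g (u - rel i) + density k * g (t - rel k).
Proof.
move=> vI iI kI xit xku iu kt.
have [lambda [gamma [N [[_ _ feas] [slack _]]]]] := exists_certificate vI.
have := slack _ _ iI xit; have := slack _ _ kI xku.
have := feas _ _ iI iu; have := feas _ _ kI kt.
by lra.
Qed.

(* Job [J1] has release time 0 and length [D + r], job [J2] release time [r] and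
   length [D - r]: whichever [A] orders first at time [r], the switch happens
   when the delay of the other one is exactly [D]. *)
Lemma left_jump_transfer D r h : 0 < r -> r < D -> 0 < h -> h <= D - r ->
  g D - g (D - h) <= g (D + r) - g (D + r - h) \/
  g D - g (D - h) <= g (D - r) - g (D - r - h).
Proof.
move=> r0 rD h0 hDr.
pose J1 := Job 0 0 (D + r) (D + r); pose J2 := Job 1 r (D - r) (D - r).
pose I : instance R := [fset J1; J2]%fset.
have J1I : J1 \in I by rewrite !inE eqxx.
have J2I : J2 \in I by rewrite !inE eqxx orbT.
have J12 : J1 != J2 by apply/eqP => -[].
have inI j : j \in I -> j = J1 \/ j = J2.
  by rewrite !inE => /orP[]/eqP; [left|right].
have vI : valid_instance I.
  by move=> j /inI[] -> /=; split; lra.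
have sched : schedule 1 I (A I) by case: A_online => AS _; exact: AS.
have density1 : density J1 = 1 by rewrite /density divff//= gt_eqF//; lra.
have density2 : density J2 = 1 by rewrite /density divff//= gt_eqF//; lra.
have sumE t : \sum_(j <- I) A I j t = A I J1 t + A I J2 t.
  by rewrite big_fsetU1 ?inE//= big_seq_fset1.
have ge01 t := schedule_ge0 sched J1I t.
have ge02 t := schedule_ge0 sched J2I t.
have full t : busy I (A I) t -> A I J1 t + A I J2 t = 1.
  by move=> bt; rewrite -sumE; exact: busy_full_speed.
have idle j t : j \in I -> ~~ pending (A I) j t -> A I j t = 0.
  move=> jI; apply: contraNeq => x_neq0; apply: executes_pending => //.
  by rewrite lt_def x_neq0 (schedule_ge0 sched).
have p1_le t : 0 <= t -> processed (A I) J1 t <= t.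
  move=> t0; have := processed_lipschitz sched J1I (lexx _) t0.
  by rewrite processed_release/= add0r mul1r subr0.
have p2_le t : r <= t -> processed (A I) J2 t <= t - r.
  move=> rt; have := processed_lipschitz sched J2I (lexx _) rt.
  by rewrite processed_release/= add0r mul1r.
have pend1 t : 0 <= t -> t < D + r -> pending (A I) J1 t.
  by move=> t0 tDr; rewrite /pending/= t0 (le_lt_trans (p1_le _ t0)).
have pend2 t : r <= t -> t < D -> pending (A I) J2 t.
  by move=> rt tD; rewrite /pending/= rt (le_lt_trans (p2_le _ rt))// ltrD2r.
have rI : release_time I r by exists J2.
have [s s_perm rule] := A_class vI rI.
have no_release t i : i \in I -> ~~ (r < rel i <= t).
  by move=> /inI[]-> /=; rewrite ?ltxx//; rewrite ltNge (ltW r0).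
have memE i : i \in s = (i \in I) && pending (A I) i r.
  by rewrite (perm_mem s_perm) !inE.
have J2s : J2 \in s by rewrite memE J2I (pend2 r).
case: s s_perm rule memE J2s => // k l _ rule memE _.
have kI : k \in I by have := memE k; rewrite inE eqxx => /esym/andP[].
have head_runs t : r <= t -> pending (A I) k t -> A I k t = 1.
  by move=> rt pk; rewrite (rule _ rt)//=; [rewrite pk/= eqxx|move=> i; exact: no_release].
have [kE|kE] := inI _ kI; subst k.
  (* [J1] first: it runs alone until [D + r], when [J2] starts with delay [D]. The exchange is made
     between [D + r - h] and [D + r]. *)
  left; have run1 t : r <= t -> t < D + r -> A I J1 t = 1.
    by move=> rt tDr; apply: head_runs => //; apply: pend1 => //; lra.
  have run1' t : 0 < t < D + r -> 1 <= A I J1 t <= 1.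
    move=> /andP[t0 tDr]; have [rt|tr] := leP r t; first by rewrite run1// lexx.
    have := full t; rewrite (schedule_before_release sched J2I)// addr0 => ->.
      by rewrite lexx.
    by exists J1 => //; apply: pend1 => //; exact: ltW.
  have idle2 t : r < t < D + r -> 0 <= A I J2 t <= 0.
    move=> /andP[rt tDr]; have rt' := ltW rt; have := full t; rewrite run1//.
    have := ge02 t; move=> ? /(_ _)H.
    have : 1 + A I J2 t = 1 by apply: H; exists J1 => //; apply: pend1 => //; lra.
    by lra.
  have Dr0 : 0 <= D + r by lra.
  have rDr : r <= D + r by lra.
  have := processed_increment sched J1I (lexx _) Dr0 run1'.
  rewrite processed_release/= !subr0 !mul1r => p1.
  have := processed_increment sched J2I (lexx _) rDr idle2.
  rewrite processed_release/= !subr0 !mul0r => p2.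
  have x2 : A I J2 (D + r) = 1.
    rewrite -(full (D + r)); last first.
      by exists J2 => //; rewrite /pending/=; apply/andP; split; lra.
    rewrite [A I J1 _]idle ?add0r//.
    by rewrite /pending/= negb_and -!leNgt; apply/orP; right; lra.
  have x1 : A I J1 (D + r - h) = 1 by apply: run1; lra.
  have := @exchange_inequality I J1 J2 (D + r - h) (D + r) vI J1I J2I.
  rewrite x1 x2 density1 density2 !mul1r/= !subr0 => /(_ ltr01 ltr01 Dr0).
  have -> : D + r - r = D by lra.
  have -> : D + r - h - r = D - h by lra.
  have t_ge : r <= D + r - h by lra.
  by move=> /(_ t_ge); lra.
(* [J2] first: it runs on [[r, D)], and [J1] resumes at [D] with delay [D]. The exchange is made
   between [D - h] and [D]. *)
right; have run2 t : r <= t -> t < D -> A I J2 t = 1.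
  by move=> rt tD; apply: head_runs => //; exact: pend2.
have run2' t : r < t < D -> 1 <= A I J2 t <= 1.
  by move=> /andP[rt tD]; rewrite run2// ?lexx// ltW.
have := processed_increment sched J2I (lexx _) (ltW rD) run2'.
rewrite processed_release/= !subr0 !mul1r => p2.
have x1 : A I J1 D = 1.
  rewrite -(full D); last by exists J1 => //; apply: pend1; lra.
  rewrite [A I J2 D]idle ?addr0//.
  by rewrite /pending/= negb_and -!leNgt; apply/orP; right; lra.
have x2 : A I J2 (D - h) = 1 by apply: run2; lra.
have := @exchange_inequality I J2 J1 (D - h) D vI J2I J1I.
rewrite x1 x2 density1 density2 !mul1r/= !subr0 => /(_ ltr01 ltr01 (ltW rD)).
have -> : D - h - r = D - r - h by lra.
have t_ge : 0 <= D - h by lra.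
by move=> /(_ t_ge); lra.
Qed.

(* A left jump of [g] at [D] would reappear at [D + r] or [D - r] for every
   [r] in [(0, D)], so the bounded monotone function [g] would have arbitrarily
   many jumps of at least that size on [[0, 2 * D]]. *)
Lemma cost_left_continuous D e : 0 < D -> 0 < e ->
  exists h, [/\ 0 < h, h <= D & g D - g (D - h) <= e].
Proof.
(* More than [g (2 * D) / e] jumps exceeding [e] cannot fit below [g (2 * D)]; the step
   [D / (n + 1)] makes the leftmost point [D - n * h - h] equal to 0. *)
move=> D0 e0; pose n := (Num.truncn (g (D + D) / e)).+1.
have n_gt : g (D + D) < n%:R * e.
  by rewrite -ltr_pdivrMr// /n truncnS_gt.
pose h := D / n.+1%:R.
have h0 : 0 < h by rewrite divr_gt0.
have nh : n%:R * h + h = D.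
  by rewrite -[X in _ + X]mul1r -mulrDl natr1 /h mulrC divfK.
have nh0 : 0 <= n%:R * h by rewrite mulr_ge0// ltW.
exists h; split => //; first by lra.
(* The increase of [g] over an interval around [D]. Passing to [k + 1] adds a piece of length [h] on
   each side, and the transfer with [r = (k + 1) * h] finds the jump on one of them. *)
pose phi k := g (D + k%:R * h) - g (D - k%:R * h - h).
have step k : (k <= n)%N -> k%:R * (g D - g (D - h)) <= phi k - phi 0%N.
  elim: k => [_|k IH kn]; first by rewrite mul0r subrr.
  have kn' : k%:R * h + h <= n%:R * h.
    have -> : k%:R * h + h = k.+1%:R * h by rewrite -natr1 mulrDl mul1r.
    by apply: ler_wpM2r; [exact: ltW|rewrite ler_nat].
  have kh0 : 0 <= k%:R * h by rewrite mulr_ge0// ltW.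
  have := IH (ltnW kn); rewrite -natr1 mulrDl mul1r.
  rewrite {1 3}/phi -natr1 [(_ + 1) * h]mulrDl mul1r; move: (phi 0%N) => phi0.
  move: kn' kh0; set x := k%:R * h => kn' kh0 le_k.
  have xh0 : 0 < x + h by lra.
  have xhD : x + h < D by lra.
  have hDx : h <= D - (x + h) by lra.
  have := left_jump_transfer xh0 xhD h0 hDx.
  rewrite (_ : D + (x + h) - h = D + x); last by lra.
  rewrite (_ : D - (x + h) = D - x - h); last by lra.
  have m1 : g (D + x) <= g (D + (x + h)) by apply: g_nondecreasing; lra.
  have m2 : g (D - x - h - h) <= g (D - x - h) by apply: g_nondecreasing; lra.
  by case=> jump; lra.
have := step n (leqnn n).
have g2D : g (D + n%:R * h) <= g (D + D) by apply: g_nondecreasing; lra.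
have phi0 : 0 <= phi 0%N.
  by rewrite /phi mul0r addr0 subr0 subr_ge0; apply: g_nondecreasing; lra.
have gD0 : 0 <= g (D - n%:R * h - h) by apply: g_ge0; lra.
move=> le_n; have le_n' : n%:R * (g D - g (D - h)) <= n%:R * e.
  by move: le_n phi0; rewrite {1}/phi; lra.
by move: le_n'; rewrite ler_pM2l// ltr0n.
Qed.

(** Slackness and [0 <= gamma] give the bound at times arbitrarily close to completion at which [j]
    runs; left-continuity of [g] carries it to the completion time. *)
Lemma integral_delay_le_lambda I lambda gamma N j : valid_instance I ->
  dual_feasible g I lambda gamma ->
  complementary_slackness g I (A I) lambda gamma N -> j \in I ->
  density j * g (completion (A I) j - rel j) <= lambda j.
Proof.
move=> vI [_ gamma_ge0 _] [slack _] jI.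
have sched : schedule 1 I (A I) by case: A_online => AS _; exact: AS.
have d0 := density_gt0 vI jI.
apply/ler_addgt0Pr => e e0.
have D0 : 0 < completion (A I) j - rel j.
  rewrite subr_gt0.
  exact: (pending_lt_completion sched jI (pending_release (A I) vI jI)).
have [|h [h0 hD g_le]] := @cost_left_continuous _ (e / density j) D0.
  exact: divr_gt0.
have [t [rt Ct xt]] := executes_near_completion A_online vI jI h0.
have := slack _ _ jI xt; have := gamma_ge0 t.
have : density j * g (completion (A I) j - rel j - h) <= density j * g (t - rel j).
  by rewrite ler_pM2l//; apply: g_nondecreasing; lra.
have : density j * (g (completion (A I) j - rel j) -
    g (completion (A I) j - rel j - h)) <= e.
  by rewrite -ler_pdivlMl// mulrC.
by rewrite mulrBr; lra.
Qed.

End DualAlgorithm.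

(** * Fractional optimality and the integral competitive ratio *)

Theorem theorem5 (R : realType) (g : R -> R)
    (g_ge0 : forall t : R, 0 <= t -> 0 <= g t)
    (g_nondecreasing : forall s t : R, 0 <= s -> s <= t -> g s <= g t)
    (g0 : g 0 = 0)
    (A : algorithm R) (A_online : online A) (A_class : class_A A)
    (A_dual : forall I : instance R, valid_instance I ->
       exists lambda : R -> job R -> R, dual_assignment g A I lambda) :
  optimal_fractional g A /\
  forall eps : R, 0 < eps ->
    speed_competitive g (1 + eps) ((1 + eps) / eps) A.
Proof.
have sched I : valid_instance I -> schedule 1 I (A I) by exact: A_online.1.
have total I (vI : valid_instance I) j := integral_rate_eq A_online A_class vI (j := j).
have certificate := exists_certificate A_online A_class A_dual.
split=> [I vI|eps eps0 I vI x x_sched];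
    have [lambda [gamma [N [feas slack]]]] := certificate I vI.
  split; first by exists (A I) => //; exact: sched.
  move=> x x_sched.
  apply: (fractional_optimality g_ge0 g_nondecreasing vI _ _ feas slack x_sched).
    exact: sched.
  exact: total.
have inv_ge0 : 0 <= (1 + eps)^-1 by rewrite invr_ge0; lra.
have := dual_value_le_integral_cost g_ge0 g_nondecreasing vI (sched I vI)
  (total I vI) feas slack x_sched inv_ge0.
set Lambda := \sum_(j <- I) _ => Lambda_le.
have cost_le : integral_cost g I (A I) <= Lambda.
  rewrite /integral_cost /Lambda !big_seq; apply: ler_sum => j jI.
  have p0 := proc_gt0 vI jI.
  rewrite -ler_pdivrMr// mulrAC.
  exact: (integral_delay_le_lambda g_ge0 g_nondecreasing A_online A_class A_dual vI feas slack jI).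
apply: le_trans cost_le _; rewrite mulrAC ler_pdivlMr//.
have e1 : 0 < 1 + eps by lra.
(* Scaling by [1 + eps] leaves [eps * Lambda <= (1 + eps) * integral_cost g I x]. *)
have : (1 + eps) * Lambda <= (1 + eps) * (integral_cost g I x + (1 + eps)^-1 * Lambda).
  by rewrite ler_pM2l.
by rewrite mulrDr mulVKf ?gt_eqF//; lra.
Qed.
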